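(* Let Assumptions A and B (see context) hold. Let $\{x_k\}_{k\ge 0}$ be a sequence generated by the synchronous inexact proximal best-response scheme (see context) with deterministic inexactness sequences satisfying $\alpha_{i,k}\ge 0$ and $\sum_{k=0}^\infty \alpha_{i,k}<\infty$ for every $i\in\{1,\dots,N\}$. Then for every $i\in\{1,\dots,N\}$, $$\lim_{k\to\infty}x_{i,k}=x_i^*\quad\text{almost surely},$$ where $x^*=(x_1^*,\dots,x_N^* )$ is the unique Nash equilibrium of the game.
   Context: Game. There are $N$ players $\mathcal N=\{1,\dots,N\}$. Player $i$ has strategy set $X_i\subseteq\mathbb R^{n_i}$; $X=\prod_i X_i$, $X_{-i}=\prod_{j\ne i}X_j$, $x_{-i}=(x_j)_{j\ne i}$. Let $\xi:\Omega\to\mathbb R^d$ be a random vector on a probability space $(\Omega,\mathcal F,\mathbb P)$. Given $x_{-i}\in X_{-i}$, player $i$ minimizes over $x_i\in X_i$ the function $f_i(x_i,x_{-i})=\mathbb E[\psi_i(x_i,x_{-i};\xi)]$. A Nash equilibrium is a point $x^*\in X$ such that, for every $i$, $x_i^*$ minimizes $f_i(\cdot,x_{-i}^* )$ over $X_i$. $\|\cdot\|$ is the Euclidean norm for vectors and the induced spectral norm for matrices. Assumption A. For every $i$: (a) $X_i$ is closed, compact and convex (nonempty); (b) for every $x_{-i}\in X_{-i}$, $f_i(\cdot,x_{-i})$ is convex and twice continuously differentiable on an open set containing $X_i$; moreover $f_i$ is twice differentiable in $x$ on an open set containing $X$; (c) for all $x_{-i}\in X_{-i}$ and all $\omega\in\Omega$,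 $\psi_i(\cdot,x_{-i};\xi(\omega))$ is differentiable on an open set containing $X_i$, and $\nabla_{x_i}f_i(x_i,x_{-i})=\mathbb E[\nabla_{x_i}\psi_i(x_i,x_{-i};\xi)]$; (d) there is $M_i>0$ with $\mathbb E[\|\nabla_{x_i}\psi_i(x_i,x_{-i};\xi)\|^2]\le M_i^2$ for all $x\in X$. Proximal best-response. Fix $\mu>0$. For $y\in X$, $\hat x_i(y)=\operatorname{argmin}_{x_i\in X_i}\left[f_i(x_i,y_{-i})+\frac{\mu}{2}\|x_i-y_i\|^2\right]$. Matrix $\Gamma$. Let $\zeta_{i,\min}=\inf_{x\in X}\lambda_{\min}(\nabla^2_{x_i}f_i(x))$ and $\zeta_{ij,\max}=\sup_{x\in X}\|\nabla^2_{x_ix_j}f_i(x)\|$ for $j\ne i$, where $\lambda_{\min}(A)$ is the smallest eigenvalue of $(A+A^T)/2$. $\Gamma\in\mathbb R^{N\times N}$ has entries $\Gamma_{ii}=\frac{\mu}{\mu+\zeta_{i,\min}}$ and $\Gamma_{ij}=\frac{\zeta_{ij,\max}}{\mu+\zeta_{i,\min}}$ for $j\neq i$. Assumption B. $\|\Gamma\|<1$. (Under Assumptions A and B the game has a unique Nash equilibrium $x^*$.) Synchronous inexact proximal best-response scheme. Start from $x_{i,0}\in X_i$, $i=1,\dots,N$. Given deterministic sequences $\{\alpha_{i,k}\}_{k\ge0}$, at each iteration $k=0,1,2,\dots$ every player $i$ chooses an $X_i$-valued random vector $x_{i,k+1}$ satisfying $\mathbb E[\|x_{i,k+1}-\hat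 x_i(x_k)\|^2\mid\mathcal F_k]\le\alpha_{i,k}^2$ almost surely, where $x_k=(x_{1,k},\dots,x_{N,k})$ and $\mathcal F_k$ is the $\sigma$-field of the entire information used by the algorithm up to and including the update of $x_k$ (so $\mathcal F_k\subseteq\mathcal F_{k+1}$ and $x_k$ is $\mathcal F_k$-measurable). *)

(* Defs.v *)
From HB Require Import structures.
From mathcomp Require Import all_boot all_order all_algebra.
From mathcomp Require Import all_classical all_reals all_analysis.
Set Implicit Arguments.
Unset Strict Implicit.
Unset Printing Implicit Defensive.
Import Order.TTheory GRing.Theory Num.Theory.
Import numFieldNormedType.Exports.
Local Open Scope classical_set_scope.
Local Open Scope ring_scope.

(* R^m is 'rV[R]_m.  The library norm `|x| on 'rV[R]_m is the sup norm: it is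
   used only through the (norm-independent) topology and differentiability. *)

Section Euclidean.
Context {R : realType}.

Definition enorm m (x : 'rV[R]_m) : R := Num.sqrt (\sum_j x 0 j ^+ 2).

(* Points are row vectors, so A x is written u *m A^T. *)
Definition opnorm p q (A : 'M[R]_(p, q)) : R :=
  sup [set enorm (u *m A^T) | u in [set u : 'rV[R]_q | enorm u <= 1]].

Definition lambda_min m (A : 'M[R]_m) : R :=
  inf [set a | eigenvalue (2^-1 *: (A + A^T)) a].

Definition gradient m (g : 'rV[R]_m -> R) (x : 'rV[R]_m) : 'rV[R]_m :=
  \row_a 'D_(delta_mx 0 a) g x.

(* Entry (a, b) is the b-th partial derivative of the a-th partial derivative. *)
Definition hessian m (g : 'rV[R]_m -> R) (x : 'rV[R]_m) : 'M[R]_m :=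
  \matrix_(a, b) 'D_(delta_mx 0 b) ('D_(delta_mx 0 a) g) x.

Definition twice_differentiable_on m (U : set 'rV[R]_m)
    (g : 'rV[R]_m -> R) : Prop :=
  forall x, U x ->
    differentiable g x /\ forall a, differentiable ('D_(delta_mx 0 a) g) x.

(* U is meant to be open, so continuity at the points of U is not relative
   to U. *)
Definition twice_continuously_differentiable_on m (U : set 'rV[R]_m)
    (g : 'rV[R]_m -> R) : Prop :=
  twice_differentiable_on U g /\
  forall x, U x ->
    forall a b, {for x, continuous ('D_(delta_mx 0 b) ('D_(delta_mx 0 a) g))}.

End Euclidean.

Section RandomVectors.
Context {R : realType} {disp : measure_display} {T : measurableType disp}.

(* Borel measurability of Y with respect to the sigma-algebra G on T. *)
Definition vec_measurable m (G : set_system T) (Y : T -> 'rV[R]_m) : Prop :=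
  preimage_set_system setT Y <<s [set U : set 'rV[R]_m | open U] >> `<=` G.

Definition integrable_rv (P : probability T R) (Z : T -> R) : Prop :=
  P.-integrable setT (EFin \o Z).

Definition vec_expectation (P : probability T R) m (Y : T -> 'rV[R]_m) :
    'rV[R]_m :=
  \row_a fine 'E_P[fun w => Y w 0 a].

(* Y is a version of the conditional expectation E[Z | G]. *)
Definition is_cond_expectation (P : probability T R) (G : set_system T)
    (Z Y : T -> R) : Prop :=
  [/\ integrable_rv P Z,
      integrable_rv P Y,
      preimage_set_system setT Y measurable `<=` G
    & forall A, G A ->
        (\int[P]_(w in A) (Y w)%:E = \int[P]_(w in A) (Z w)%:E)%E].

Definition filtration (F : nat -> set_system T) : Prop :=
  forall k, [/\ sigma_algebra setT (F k), F k `<=` measurable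
              & F k `<=` F k.+1].

End RandomVectors.

Section Game.
Context {R : realType} {N : nat} {n : 'I_N -> nat}.

(* A profile x = (x_1, ..., x_N) is a concatenated row vector, with blocks
   x_i = submxrow x i. *)
Local Notation profile := 'rV[R]_(\sum_i n i)%N.

Definition feasible (X : forall i, set 'rV[R]_(n i)) : set profile :=
  [set x | forall i, X i (submxrow x i)].

(* x_{-i} \in X_{-i}; the block x_i is unconstrained. *)
Definition rivals_feasible (X : forall i, set 'rV[R]_(n i)) (i : 'I_N) :
    set profile :=
  [set x | forall j, j != i -> X j (submxrow x j)].

(* (z, x_{-i}) *)
Definition deviate (x : profile) (i : 'I_N) (z : 'rV[R]_(n i)) : profile :=
  \mxrow_j dfwith (fun j => submxrow x j) i z j.

Definition pgradient (i : 'I_N) (g : profile -> R) (x : profile) :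
    'rV[R]_(n i) :=
  submxrow (gradient g x) i.

Definition phessian (i j : 'I_N) (g : profile -> R) (x : profile) :
    'M[R]_(n i, n j) :=
  submxblock (hessian g x) i j.

Definition nash_equilibrium (X : forall i, set 'rV[R]_(n i))
    (f : 'I_N -> profile -> R) (x : profile) : Prop :=
  feasible X x /\
  forall i z, X i z -> f i x <= f i (deviate x z).

Definition argmin m (A : set 'rV[R]_m) (g : 'rV[R]_m -> R) : 'rV[R]_m :=
  get [set z | A z /\ forall z', A z' -> g z <= g z'].

Definition prox_best_response (X : forall i, set 'rV[R]_(n i))
    (f : 'I_N -> profile -> R) (mu : R) (i : 'I_N) (y : profile) :
    'rV[R]_(n i) :=
  argmin (X i) (fun z =>
    f i (deviate y z) + mu / 2 * enorm (z - submxrow y i) ^+ 2).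

Definition zeta_min (X : forall i, set 'rV[R]_(n i))
    (f : 'I_N -> profile -> R) (i : 'I_N) : R :=
  inf [set lambda_min (phessian i i (f i) x) | x in feasible X].

Definition cross_hessian_norms (X : forall i, set 'rV[R]_(n i))
    (f : 'I_N -> profile -> R) (i j : 'I_N) : set R :=
  [set opnorm (phessian i j (f i) x) | x in feasible X].

Definition zeta_max (X : forall i, set 'rV[R]_(n i))
    (f : 'I_N -> profile -> R) (i j : 'I_N) : R :=
  sup (cross_hessian_norms X f i j).

Definition Gamma (X : forall i, set 'rV[R]_(n i))
    (f : 'I_N -> profile -> R) (mu : R) : 'M[R]_N :=
  \matrix_(i, j) ((if j == i then mu else zeta_max X f i j)
                  / (mu + zeta_min X f i)).

(* Since sup is 0 on sets that are not bounded above, the finiteness of the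
   suprema, implicit in Gamma being a real matrix, is stated separately. *)
Definition assumptionB (X : forall i, set 'rV[R]_(n i))
    (f : 'I_N -> profile -> R) (mu : R) : Prop :=
  (forall i j, j != i -> has_ubound (cross_hessian_norms X f i j)) /\
  opnorm (Gamma X f mu) < 1.

Section Stochastic.
Context {disp : measure_display} {T : measurableType disp} {d : nat}.

Definition objective (P : probability T R) (xi : T -> 'rV[R]_d)
    (psi : 'I_N -> profile -> 'rV[R]_d -> R) (i : 'I_N) (x : profile) : R :=
  fine 'E_P[fun w => psi i x (xi w)].

(* The integrability clauses say that f_i is well defined (real valued) where
   its regularity is asserted, and that E[grad psi_i] makes sense.  An open
   neighbourhood of the compact convex set X_i contains a convex one, so
   requiring W to be convex is no restriction. *)
Record assumptionA (P : probability T R) (xi : T -> 'rV[R]_d)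
    (psi : 'I_N -> profile -> 'rV[R]_d -> R)
    (X : forall i, set 'rV[R]_(n i)) : Prop := AssumptionA {
  strategy_sets : forall i,
    [/\ X i !=set0, closed (X i), compact (X i) & convex_set (X i)];
  own_regularity : forall i x, rivals_feasible X i x ->
    exists W : set 'rV[R]_(n i),
      [/\ open W, X i `<=` W & convex_set W] /\
      [/\ forall z, W z ->
            integrable_rv P (fun w => psi i (deviate x z) (xi w)),
          convex_function W (fun z => objective P xi psi i (deviate x z))
        & twice_continuously_differentiable_on W
            (fun z => objective P xi psi i (deviate x z))];
  joint_regularity : forall i,
    exists U : set profile,
      [/\ open U, feasible X `<=` U,
          forall x, U x -> integrable_rv P (fun w => psi i x (xi w))
        & twice_differentiable_on U (objective P xi psi i)];
  psi_differentiable : forall i x, rivals_feasible X i x -> forall w,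
    exists W : set 'rV[R]_(n i),
      [/\ open W, X i `<=` W
        & forall z, W z ->
            differentiable (fun z => psi i (deviate x z) (xi w)) z];
  gradient_expectation : forall i x, feasible X x ->
    (forall a, integrable_rv P (fun w => pgradient i (psi i ^~ (xi w)) x 0 a)) /\
    pgradient i (objective P xi psi i) x =
      vec_expectation P (fun w => pgradient i (psi i ^~ (xi w)) x);
  gradient_moment : forall i, exists2 M : R, 0 < M &
    forall x, feasible X x ->
      ('E_P[fun w => (enorm (pgradient i (psi i ^~ (xi w)) x) ^+ 2)%R]
         <= (M ^+ 2)%:E)%E
}.

(* F k is the information available once x k has been updated. *)
Record inexact_prox_scheme (P : probability T R)
    (X : forall i, set 'rV[R]_(n i)) (f : 'I_N -> profile -> R) (mu : R)
    (alpha : 'I_N -> nat -> R) (F : nat -> set_system T)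
    (x : nat -> T -> profile) : Prop := InexactProxScheme {
  scheme_filtration : filtration F;
  scheme_adapted : forall k, vec_measurable (F k) (x k);
  scheme_feasible : forall k w, feasible X (x k w);
  scheme_inexact : forall i k, exists2 Y : T -> R,
    is_cond_expectation P (F k)
      (fun w => enorm (submxrow (x k.+1 w) i
                       - prox_best_response X f mu i (x k w)) ^+ 2) Y
    & {ae P, forall w, Y w <= alpha i k ^+ 2}
}.

End Stochastic.
End Game.

(* Main.v *)
Require Import Defs.
From HB Require Import structures.
From mathcomp Require Import all_boot all_order all_algebra.
From mathcomp Require Import all_classical all_reals all_analysis.
From mathcomp Require Import measurable_realfun.
From mathcomp Require Import ring lra.
Import Order.TTheory GRing.Theory Num.Theory.
Import numFieldNormedType.Exports.
Local Open Scope classical_set_scope.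
Local Open Scope ring_scope.

(* Adding the first-order optimality conditions of two proximal responses
   [z = xhat_i(y)] and [z' = xhat_i(y')] and applying the mean value theorem to
   the partial gradient of [f_i] along the segment joining [(z, y_{-i})] to
   [(z', y'_{-i})] gives
     (mu + zeta_i) |z - z'| <= mu |y_i - y'_i| + sum_j zeta_ij |y_j - y'_j|,
   where [zeta_i >= 0] because [f_i] is convex in [x_i].  Hence the joint
   proximal response is a contraction of ratio [q = ||Gamma|| < 1] on the compact
   set [X]; a minimizer of [|y - xhat(y)|] is a fixed point, and fixed points are
   exactly the Nash equilibria.  Since [sum_k E|x_{i,k+1} - xhat_i(x_k)|^2 <=
   sum_k alpha_{i,k}^2 < oo], the errors [d_k = |x_{k+1} - xhat(x_k)|] tend to 0
   almost surely, and [|x_{k+1} - x*| <= q |x_k - x*| + d_k] concludes pathwise. *)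

Set Implicit Arguments.
Unset Strict Implicit.
Unset Printing Implicit Defensive.

(** * Euclidean geometry *)

Section Euclidean.
Context {R : realType}.

Definition dotv m (u v : 'rV[R]_m) : R := \sum_j u 0 j * v 0 j.

Lemma dotvC m (u v : 'rV[R]_m) : dotv u v = dotv v u.
Proof. by apply: eq_bigr => j _; rewrite mulrC. Qed.

Lemma dotvDl m (u v w : 'rV[R]_m) : dotv (u + v) w = dotv u w + dotv v w.
Proof. by rewrite -big_split; apply: eq_bigr => j _; rewrite !mxE mulrDl. Qed.

Lemma dotvZl m a (u w : 'rV[R]_m) : dotv (a *: u) w = a * dotv u w.
Proof. by rewrite /dotv mulr_sumr; apply: eq_bigr => j _; rewrite !mxE mulrA. Qed.

Lemma dotvNl m (u w : 'rV[R]_m) : dotv (- u) w = - dotv u w.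
Proof. by rewrite -scaleN1r dotvZl mulN1r. Qed.

Lemma dotvBl m (u v w : 'rV[R]_m) : dotv (u - v) w = dotv u w - dotv v w.
Proof. by rewrite dotvDl dotvNl. Qed.

Lemma dotvDr m (u v w : 'rV[R]_m) : dotv w (u + v) = dotv w u + dotv w v.
Proof. by rewrite !(dotvC w) dotvDl. Qed.

Lemma dotvZr m a (u w : 'rV[R]_m) : dotv w (a *: u) = a * dotv w u.
Proof. by rewrite !(dotvC w) dotvZl. Qed.

Lemma dotvNr m (u w : 'rV[R]_m) : dotv w (- u) = - dotv w u.
Proof. by rewrite !(dotvC w) dotvNl. Qed.

Definition dotvE := (dotvDl, dotvDr, dotvZl, dotvZr, dotvNl, dotvNr).

Lemma dotv_ge0 m (u : 'rV[R]_m) : 0 <= dotv u u.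
Proof. by apply: sumr_ge0 => j _; rewrite -expr2 sqr_ge0. Qed.

Lemma dotv_eq0 m (u : 'rV[R]_m) : dotv u u = 0 -> u = 0.
Proof.
move/eqP; rewrite psumr_eq0 => [/allP u0|j _]; last by rewrite -expr2 sqr_ge0.
apply/rowP => j; rewrite mxE; have := u0 j (mem_index_enum j).
by rewrite /= mulf_eq0 orbb => /eqP.
Qed.

Lemma dotv0l m (u : 'rV[R]_m) : dotv 0 u = 0.
Proof. by rewrite -(scale0r 0) dotvZl mul0r. Qed.

Lemma dotv0r m (u : 'rV[R]_m) : dotv u 0 = 0.
Proof. by rewrite dotvC dotv0l. Qed.

Lemma dotv_gt0 m (u : 'rV[R]_m) : u != 0 -> 0 < dotv u u.
Proof.
move=> u0; rewrite lt_neqAle dotv_ge0 andbT eq_sym.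
by apply: contra_neq u0; exact: dotv_eq0.
Qed.

Lemma dotv_mulmx m p (u : 'rV[R]_m) (A : 'M[R]_(p, m)) (v : 'rV[R]_p) :
  dotv v (u *m A^T) = dotv (v *m A) u.
Proof.
rewrite /dotv; under eq_bigr do rewrite mxE mulr_sumr.
rewrite exchange_big; apply: eq_bigr => j _; rewrite mxE mulr_suml.
by apply: eq_bigr => k _; rewrite mxE mulrAC mulrA.
Qed.

Lemma enorm_sqr m (u : 'rV[R]_m) : enorm u ^+ 2 = dotv u u.
Proof.
rewrite /enorm sqr_sqrtr; last by apply: sumr_ge0 => j _; rewrite sqr_ge0.
by apply: eq_bigr => j _; rewrite expr2.
Qed.

Lemma enorm_sqr_line m (u v : 'rV[R]_m) t : enorm (u + t *: v) ^+ 2 =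
  enorm u ^+ 2 + 2 * t * dotv u v + t ^+ 2 * enorm v ^+ 2.
Proof. by rewrite !enorm_sqr !dotvE (dotvC v u); ring. Qed.

Lemma enorm_ge0 m (u : 'rV[R]_m) : 0 <= enorm u.
Proof. exact: sqrtr_ge0. Qed.
#[local] Hint Resolve enorm_ge0 : core.

Lemma enorm0 m : enorm (0 : 'rV[R]_m) = 0.
Proof.
by rewrite /enorm big1 ?sqrtr0// => j _; rewrite mxE expr0n.
Qed.

Lemma enorm_eq0 m (u : 'rV[R]_m) : enorm u = 0 -> u = 0.
Proof. by move=> u0; apply: dotv_eq0; rewrite -enorm_sqr u0 expr0n. Qed.

Lemma enormZ m a (u : 'rV[R]_m) : enorm (a *: u) = `|a| * enorm u.
Proof.
apply/eqP; rewrite -(eqrXn2 (ltn0Sn 1))//; last by rewrite mulr_ge0.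
by rewrite exprMn !enorm_sqr !dotvE real_normK ?num_real// mulrA expr2.
Qed.

Lemma enormN m (u : 'rV[R]_m) : enorm (- u) = enorm u.
Proof. by rewrite -scaleN1r enormZ normrN1 mul1r. Qed.

Lemma enormC m (u v : 'rV[R]_m) : enorm (u - v) = enorm (v - u).
Proof. by rewrite -enormN opprB. Qed.

(** Cauchy-Schwarz: with [a], [b], [c] as set in the proof, the squared norm of [b *: u - c *: v] is
    [b (a b - c^2)], and [b > 0]. *)
Lemma dotv_le m (u v : 'rV[R]_m) : dotv u v <= enorm u * enorm v.
Proof.
have [->|v0] := eqVneq v 0.
  by rewrite enorm0 mulr0 dotv0r.
have b0 := dotv_gt0 v0.
have := dotv_ge0 (dotv v v *: u - dotv u v *: v); rewrite !dotvE (dotvC v u).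
set a := dotv u u; set b := dotv v v in b0 *; set c := dotv u v => h.
rewrite (le_trans (ler_norm _))// -(@ler_pXn2r R 2)// ?nnegrE ?mulr_ge0//.
rewrite real_normK ?num_real// exprMn !enorm_sqr -/a -/b.
by rewrite -(ler_pM2l b0); nra.
Qed.

Lemma enormD m (u v : 'rV[R]_m) : enorm (u + v) <= enorm u + enorm v.
Proof.
rewrite -(@ler_pXn2r R 2)// ?nnegrE ?addr_ge0//.
have := dotv_le u v; rewrite sqrrD !enorm_sqr !dotvE (dotvC v u); nra.
Qed.

Lemma enormB m (w u v : 'rV[R]_m) : enorm (u - v) <= enorm (u - w) + enorm (w - v).
Proof. by rewrite -{1}(subrK w u) -addrA enormD. Qed.

Lemma coord_le_enorm m (u : 'rV[R]_m) j : `|u 0 j| <= enorm u.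
Proof.
rewrite -sqrtr_sqr ler_wsqrtr// (bigD1 j)//= lerDl.
by apply: sumr_ge0 => k _; rewrite sqr_ge0.
Qed.

(** Together with [enorm_le_norm], this turns estimates in the Euclidean norm into topological
    statements, which refer to the sup norm. *)
Lemma norm_le_enorm m (u : 'rV[R]_m) : `|u| <= enorm u.
Proof.
rewrite [leLHS]/Num.Def.normr/= mx_normrE bigmax_le// => -[i j] _.
by rewrite ord1; exact: coord_le_enorm.
Qed.

Lemma coord_le_norm m (u : 'rV[R]_m) j : `|u 0 j| <= `|u|.
Proof.
by rewrite [leRHS]/Num.Def.normr/= mx_normrE; exact: (le_bigmax _ _ (0, j)).
Qed.

Lemma enorm_le_norm m (u : 'rV[R]_m) : enorm u <= Num.sqrt m%:R * `|u|.
Proof.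
rewrite /enorm -[X in _ * X]ger0_norm// -sqrtr_sqr -sqrtrM ?ler0n//.
rewrite ler_wsqrtr// -[X in _ <= X%:R * _]card_ord mulr_natl -sumr_const.
by apply: ler_sum => j _; rewrite -ler_sqrt ?sqr_ge0// !sqrtr_sqr normr_id coord_le_norm.
Qed.

Lemma enorm_le m (u v : 'rV[R]_m) :
  (forall j, 0 <= u 0 j <= v 0 j) -> enorm u <= enorm v.
Proof.
move=> uv; apply: ler_wsqrtr; apply: ler_sum => j _.
by have /andP[u0 ?] := uv j; rewrite lerXn2r// nnegrE (le_trans u0).
Qed.

Lemma dotv_continuous (T : topologicalType) m (f g : T -> 'rV[R]_m) :
  continuous f -> continuous g -> continuous (fun t => dotv (f t) (g t)).
Proof.
move=> cf cg t; apply: cvg_big => [|j _]; first exact: add_continuous.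
apply: cvgM.
  by apply: (cvg_comp _ (fun u : 'rV[R]_m => u 0 j) (cf t)); exact: coord_continuous.
by apply: (cvg_comp _ (fun u : 'rV[R]_m => u 0 j) (cg t)); exact: coord_continuous.
Qed.

Lemma dotv_mulmx_continuous (T : topologicalType) m p (A : 'M[R]_(m, p))
    (f : T -> 'rV[R]_m) (g : T -> 'rV[R]_p) :
  continuous f -> continuous g -> continuous (fun t => dotv (f t *m A) (g t)).
Proof.
move=> cf cg.
have -> : (fun t => dotv (f t *m A) (g t)) =
    fun t => \sum_j dotv (f t) (row j A^T) * g t 0 j.
  apply/funext => t; apply: eq_bigr => j _; congr (_ * _).
  by rewrite mxE; apply: eq_bigr => k _; rewrite !mxE.
move=> t; apply: cvg_big => [|j _]; first exact: add_continuous.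
apply: cvgM.
  by apply: (@dotv_continuous _ _ f (fun=> row j A^T)) => // ?; exact: cvg_cst.
by apply: (cvg_comp _ (fun u : 'rV[R]_p => u 0 j) (cg t)); exact: coord_continuous.
Qed.

Lemma enormE m (u : 'rV[R]_m) : enorm u = Num.sqrt (dotv u u).
Proof. by rewrite -enorm_sqr sqrtr_sqr ger0_norm. Qed.

Lemma enorm_continuous m : continuous (@enorm R m).
Proof.
have -> : @enorm R m = fun u => Num.sqrt (dotv u u).
  by apply/funext => u; exact: enormE.
move=> u; apply: (@continuous_comp _ _ _ (fun u => dotv u u) Num.sqrt).
  by apply: dotv_continuous => v; exact: cvg_id.
exact: sqrt_continuous.
Qed.

Lemma opnorm_has_sup p q (A : 'M[R]_(p, q)) :
  has_sup [set enorm (u *m A^T) | u in [set u : 'rV[R]_q | enorm u <= 1]].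
Proof.
split; first by exists (enorm (0 *m A^T)); exists 0 => //=; rewrite enorm0.
(* The upper bound is the Frobenius norm of [A], by Cauchy-Schwarz on each row. *)
exists (enorm (\row_i enorm (row i A))) => _ [u /= u1 <-].
rewrite /enorm; apply: ler_wsqrtr; apply: ler_sum => i _.
rewrite [X in _ <= X ^+ 2]mxE -[X in X <= _]real_normK ?num_real//.
rewrite lerXn2r ?nnegrE//.
have -> : (u *m A^T) 0 i = dotv u (row i A).
  by rewrite mxE; apply: eq_bigr => j _; rewrite !mxE.
have ur : enorm u * enorm (row i A) <= enorm (row i A) by rewrite ler_piMl.
rewrite ler_norml; apply/andP; split.
  by rewrite lerNl -dotvNl (le_trans _ ur)// -(enormN u) dotv_le.
exact: le_trans (dotv_le _ _) ur.
Qed.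

Lemma opnorm_ge0 p q (A : 'M[R]_(p, q)) : 0 <= opnorm A.
Proof.
apply: (@le_trans _ _ (enorm (0 *m A^T))) => //.
by apply: sup_upper_bound; [exact: opnorm_has_sup|exists 0 => //=; rewrite enorm0].
Qed.

Lemma opnormP p q (A : 'M[R]_(p, q)) u : enorm (u *m A^T) <= opnorm A * enorm u.
Proof.
have [->|u0] := eqVneq u 0; first by rewrite mul0mx !enorm0 mulr0.
have e0 : 0 < enorm u.
  by rewrite lt_neqAle enorm_ge0 andbT eq_sym; apply: contra_neq u0; exact: enorm_eq0.
rewrite -ler_pdivrMr// mulrC -[X in X * _]ger0_norm ?invr_ge0// -enormZ scalemxAl.
apply: sup_upper_bound; first exact: opnorm_has_sup.
by exists ((enorm u)^-1 *: u) => //=; rewrite enormZ ger0_norm ?invr_ge0// mulVf ?gt_eqF.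
Qed.

(** At [u = v] it shows that [A] and its symmetric part, whose spectrum defines [lambda_min], have
    the same quadratic form. *)
Lemma dotv_symmetrize m (A : 'M[R]_m) (u v : 'rV[R]_m) :
  dotv (u *m (2^-1 *: (A + A^T))) v = 2^-1 * (dotv (u *m A) v + dotv (v *m A) u).
Proof. by rewrite -scalemxAr mulmxDr !dotvE (dotvC (u *m A^T)) dotv_mulmx. Qed.

(* The minimum of the Rayleigh quotient over the unit sphere is an eigenvalue. *)
Lemma lambda_min_le m (A : 'M[R]_m) (v : 'rV[R]_m) :
  lambda_min A * dotv v v <= dotv v (v *m A^T).
Proof.
rewrite dotv_mulmx; have [->|v0] := eqVneq v 0.
  by rewrite mul0mx !dotv0r mulr0.
pose q u := dotv (u *m A) u.
have vv0 := dotv_gt0 v0.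
have [|||c] := @EVT_min_rV R m q [set u | dotv u u = 1].
- exists ((enorm v)^-1 *: v) => /=.
  by rewrite !dotvE -enorm_sqr mulrA -expr2 exprVn mulVf// enorm_sqr gt_eqF.
- apply: bounded_closed_compact.
    exists 1; split => // M M1 u /= u1; apply: le_trans (norm_le_enorm u) _.
    by rewrite enormE u1 sqrtr1 ltW.
  apply: (@closed_comp _ _ (fun u => dotv u u) [set 1]); last exact: closed_eq.
  by move=> u _; apply: dotv_continuous => w; exact: cvg_id.
- by apply/continuous_subspaceT/dotv_mulmx_continuous => u; exact: cvg_id.
rewrite inE /= => c1 cmin.
have qge w : q c * dotv w w <= q w.
  have [->|w0] := eqVneq w 0; first by rewrite /q mul0mx !dotv0r mulr0.
  have ww0 := dotv_gt0 w0.
  have := cmin ((enorm w)^-1 *: w); rewrite inE /= /q -scalemxAl !dotvE.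
  rewrite !mulrA -expr2 exprVn enorm_sqr mulVf ?gt_eqF// => /(_ erefl).
  by rewrite mulrC ler_pdivlMr// mulrC.
pose S := 2^-1 *: (A + A^T).
have qS w : dotv (w *m S) w = q w by rewrite dotv_symmetrize /q; lra.
have [r rE] : exists r, r = c *m S - q c *: c by exists (c *m S - q c *: c).
(* Stationarity of the minimizer [c]: perturbing it along the residual [r] must not decrease the
   Rayleigh quotient, which forces [r = 0], so [c] is an eigenvector. *)
have r0 : r = 0.
  apply: dotv_eq0; set D := dotv r r; pose K := q r - q c * dotv r r.
  have K0 : 0 <= K by rewrite subr_ge0.
  have h t : 0 <= t * (2 * D + t * K).
    have := qge (c + t *: r); rewrite -subr_ge0; congr (0 <= _).
    have -> : D = dotv (c *m S) r - q c * dotv c r by rewrite -dotvZl -dotvBl -rE.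
    rewrite dotv_symmetrize /K /q mulmxDl -scalemxAl !dotvE (dotvC r c) c1; field; lra.
  have K1 : 0 < K + 1 by rewrite ltr_wpDl.
  (* [K] may vanish, hence [K + 1]. With this [t], [h (- t)] reads [0 <= - t^2 (K + 2)], so
     [t = 0]. *)
  have [t Dt] : exists t, D = t * (K + 1).
    by exists (D / (K + 1)); rewrite divfK// gt_eqF.
  have t0 : t = 0.
    apply/eqP; rewrite -sqrf_eq0 eq_le sqr_ge0 andbT.
    by have := h (- t); have := sqr_ge0 t; rewrite Dt; nra.
  by rewrite Dt t0 mul0r.
have eigc : eigenvalue S (q c).
  apply/eigenvalueP; exists c; first by apply/eqP; rewrite -subr_eq0 -rE r0.
  by apply/eqP => c0; move: c1; rewrite c0 dotv0r => /eqP; rewrite eq_sym oner_eq0.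
apply: le_trans (qge v); rewrite ler_wpM2r ?dotv_ge0//.
(* [inf] lies below its members only for a set bounded below; [q c] is itself a lower bound of the
   spectrum, by [qge] at each eigenvector. *)
apply: ge_inf => //; exists (q c) => b /eigenvalueP[w wb w0].
have ww0 := dotv_gt0 w0.
by rewrite -(ler_pM2r ww0) (le_trans (qge w))// -qS wb dotvZl.
Qed.

Lemma lambda_min_ge0 m (A : 'M[R]_m) :
  (forall v, 0 <= dotv v (v *m A^T)) -> 0 <= lambda_min A.
Proof.
move=> A0; rewrite /lambda_min; set E := [set a | _].
(* When [m = 0] there is no eigenvalue, and [inf] takes its default value 0. *)
have [->|/set0P E0] := eqVneq E set0; first by rewrite inf0.
apply: lb_le_inf => // b /eigenvalueP[w wb w0].
have ww0 := dotv_gt0 w0.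
rewrite -(pmulr_lge0 _ ww0) -dotvZl -wb dotv_symmetrize.
by have := A0 w; rewrite dotv_mulmx; lra.
Qed.

End Euclidean.
#[export] Hint Extern 0 (is_true (0 <= enorm _)) => apply: enorm_ge0 : core.

(** * Calculus along lines *)

Lemma lipschitz_within_continuous (R : realType) (V W : normedModType R)
    (A : set V) (g : V -> W) (k : R) :
  (forall x y, A x -> A y -> `|g x - g y| <= k * `|x - y|) ->
  {within A, continuous g}.
Proof.
move=> gk; apply/subspace_continuousP => x Ax; apply/cvgrPdist_le => e e0.
(* No sign is assumed on [k]; [|k| + 1] is a positive Lipschitz constant. *)
have k0 : 0 < `|k| + 1 by rewrite ltr_wpDl.
near=> y.
have Ay : A y by near: y; exact: withinT.
have xy : `|x - y| <= e / (`|k| + 1).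
  near: y; apply: cvg_within; apply/nbhs_normP; exists (e / (`|k| + 1)).
    by rewrite /= divr_gt0.
  by move=> y /= /ltW.
rewrite (le_trans (gk _ _ Ax Ay))// (@le_trans _ _ ((`|k| + 1) * `|x - y|))//.
  by rewrite ler_wpM2r// (le_trans (ler_norm _))// lerDl.
by rewrite -ler_pdivlMl// mulrC.
Unshelve. all: by end_near. Qed.

Lemma lipschitz_continuous (R : realType) (V W : normedModType R)
    (g : V -> W) (k : R) :
  (forall x y, `|g x - g y| <= k * `|x - y|) -> continuous g.
Proof.
move=> gk; apply/continuous_subspace_setT.
by apply: (@lipschitz_within_continuous _ _ _ _ _ k) => x y _ _.
Qed.

Section Lines.
Context {R : realType}.

Lemma is_derive_line m (g : 'rV[R]_m -> R) (x v : 'rV[R]_m) t :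
  derivable g (x + t *: v) v ->
  is_derive t 1 (fun s => g (x + s *: v)) ('D_v g (x + t *: v)).
Proof.
have E : (fun h : R => h^-1 *: (((fun s => g (x + s *: v)) \o shift t) (h *: 1)
             - g (x + t *: v)))
       = (fun h : R => h^-1 *: ((g \o shift (x + t *: v)) (h *: v) - g (x + t *: v))).
  apply/funext => h /=; congr (_ *: (g _ - _)).
  by rewrite scalerDl [h *: 1]mulr1 addrCA.
by move=> gv; split; rewrite /derivable /derive /= E.
Qed.

Lemma line_continuous m (x v : 'rV[R]_m) : continuous (fun t : R => x + t *: v).
Proof.
by move=> t; apply: cvgD; [exact: cvg_cst|exact: scalel_continuous].
Qed.

Lemma near_line m (U : set 'rV[R]_m) (x v : 'rV[R]_m) :
  open U -> U x -> \forall t \near (0 : R)^'+, U (x + t *: v).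
Proof.
move=> oU Ux; have xv : x + t *: v @[t --> (0 : R)] --> x.
  by rewrite -[X in _ --> X]addr0 -[X in x + X](scale0r v); exact: line_continuous.
by have /(_ U) := cvg_at_right_filter xv; apply; exact: open_nbhs_nbhs.
Qed.

Lemma derive_coord m (g : 'rV[R]_m -> R) (x v : 'rV[R]_m) :
  differentiable g x -> 'D_v g x = \sum_a v 0 a * 'D_(delta_mx 0 a) g x.
Proof.
move=> gx; rewrite deriveE// {1}[v]row_sum_delta linear_sum.
by apply: eq_bigr => a _; rewrite linearZ /= deriveE.
Qed.

(** One-sided first-order test: only right difference quotients are compared, and the [C t^2] term
    disappears in the limit. It fits minimization over a convex set, where only small positive steps
    are admissible. *)
Lemma derive_ge (h : R -> R) (D c C : R) :
  is_derive (0 : R) (1 : R) h D ->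
  (\forall t \near (0 : R)^'+, h 0 - c * t - C * t ^+ 2 <= h t) -> - c <= D.
Proof.
move=> hD hge.
have hcvg : t^-1 *: ((h \o shift 0) (t *: 1) - h 0) @[t --> (0 : R)^'] --> D.
  have := @ex_derive _ _ _ _ _ _ _ hD.
  by rewrite -(@derive_val _ _ _ _ _ _ _ hD) /derivable.
have {}hcvg := cvg_dnbhs_at_right hcvg.
have lcvg : - c - C * t @[t --> (0 : R)^'+] --> - c.
  rewrite -[X in _ --> X]subr0 -[X in _ - X](mulr0 C).
  by apply: cvgB; [exact: cvg_cst|apply: cvgMr; exact: cvg_at_right_filter].
apply: ler_cvg_to lcvg hcvg _; near=> t.
have t0 : 0 < t by near: t; exact: nbhs_right_gt.
rewrite /= addr0 [t *: 1]mulr1 [_ *: _]mulrC ler_pdivlMr//.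
suff : h 0 - c * t - C * t ^+ 2 <= h t by lra.
by near: t.
Unshelve. all: by end_near. Qed.

(** The tangent inequality of convexity, obtained from [derive_ge] for [- h] with [C = 0]. *)
Lemma derive_tangent (h : R -> R) (D : R) :
  is_derive (0 : R) (1 : R) h D ->
  (forall t, 0 < t <= 1 -> h t <= (1 - t) * h 0 + t * h 1) -> D <= h 1 - h 0.
Proof.
move=> hD hc; rewrite -lerN2; apply: (@derive_ge _ _ _ 0 (is_deriveN hD)).
near=> t; have /hc : 0 < t <= 1.
  apply/andP; split; first by near: t; exact: nbhs_right_gt.
  by near: t; exact: nbhs_right_le.
by rewrite fctE; lra.
Unshelve. all: by end_near. Qed.

Lemma convex_setP m (W : set 'rV[R]_m) x y t :
  convex_set W -> W x -> W y -> 0 <= t <= 1 -> W (x + t *: (y - x)).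
Proof.
move=> cW /mem_set Wx /mem_set Wy /andP[t0 t1].
rewrite [X in W X](_ : _ = t *: y + (1 - t) *: x); last first.
  by rewrite scalerBl scale1r scalerBr addrCA.
exact/set_mem/(cW _ _ (Itv01 t0 t1) Wy Wx).
Qed.

Lemma convex_functionP m (W : set 'rV[R]_m) (g : 'rV[R]_m -> R) x y t :
  convex_function W g -> W x -> W y -> 0 <= t <= 1 ->
  g (x + t *: (y - x)) <= (1 - t) * g x + t * g y.
Proof.
move=> cg /mem_set Wx /mem_set Wy /andP[t0 t1].
rewrite [X in g X](_ : _ = t *: y + (1 - t) *: x); last first.
  by rewrite scalerBl scale1r scalerBr addrCA.
by rewrite [leRHS]addrC; exact: (cg (Itv01 t0 t1) y x Wy Wx).
Qed.

Lemma derive_gradient m (g : 'rV[R]_m -> R) (x v : 'rV[R]_m) :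
  differentiable g x -> 'D_v g x = dotv v (gradient g x).
Proof.
by move=> gx; rewrite derive_coord//; apply: eq_bigr => a _; rewrite mxE.
Qed.

(** Coordinate [a] of [u *m H^T] is the derivative along [u] of the [a]-th partial derivative, so
    the claim follows by differentiating each partial derivative along the line. *)
Lemma is_derive_gradient_line m (U : set 'rV[R]_m) g (x u v : 'rV[R]_m) t :
  twice_differentiable_on U g -> U (x + t *: u) ->
  is_derive t 1 (fun s => dotv v (gradient g (x + s *: u)))
    (dotv v (u *m (hessian g (x + t *: u))^T)).
Proof.
move=> gU Ux; set y := x + t *: u.
have [gy ggy] := gU _ Ux.
have -> : (fun s => dotv v (gradient g (x + s *: u))) =
    \sum_a v 0 a \*: (fun s => 'D_(delta_mx 0 a) g (x + s *: u)).
  apply/funext => s; rewrite fct_sumE; apply: eq_bigr => a _.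
  by rewrite mxE.
have -> : dotv v (u *m (hessian g y)^T) =
    \sum_a v 0 a *: 'D_u ('D_(delta_mx 0 a) g) y.
  apply: eq_bigr => a _; rewrite derive_coord// mxE; congr (_ * _).
  by apply: eq_bigr => b _; rewrite !mxE.
apply: is_derive_sum => a; apply: is_deriveZ; apply: is_derive_line.
exact: diff_derivable.
Qed.

Lemma gradient_tangent m (g : 'rV[R]_m -> R) (x v : 'rV[R]_m) :
  differentiable g x ->
  (forall t, 0 < t <= 1 -> g (x + t *: v) <= (1 - t) * g x + t * g (x + v)) ->
  dotv v (gradient g x) <= g (x + v) - g x.
Proof.
move=> gx gc.
have := @is_derive_line m g x v 0; rewrite scale0r addr0 derive_gradient//.
move=> /(_ (diff_derivable gx)) /derive_tangent; rewrite scale0r scale1r addr0.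
exact.
Qed.

(** Pairing with a fixed [v] makes the function scalar, so that a single intermediate point serves
    all blocks of the Hessian at once. *)
Lemma gradient_mean_value m (U : set 'rV[R]_m) g (x y v : 'rV[R]_m) :
  twice_differentiable_on U g ->
  (forall t : R, 0 <= t <= 1 -> U (x + t *: (y - x))) ->
  exists2 t, 0 <= t <= 1 & dotv v (gradient g y) - dotv v (gradient g x) =
    dotv v ((y - x) *m (hessian g (x + t *: (y - x)))^T).
Proof.
move=> gU xyU.
pose h s := dotv v (gradient g (x + s *: (y - x))).
have hd (t : R) : 0 <= t <= 1 -> is_derive t 1 h
    (dotv v ((y - x) *m (hessian g (x + t *: (y - x)))^T)).
  by move=> t01; apply: is_derive_gradient_line gU _; exact: xyU.
have [||t] := @MVT_segment R h
    (fun t => dotv v ((y - x) *m (hessian g (x + t *: (y - x)))^T)) 0 1 ler01.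
- by move=> t; rewrite in_itv /= => /andP[t0 t1]; apply: hd; rewrite !ltW.
- apply: continuous_in_subspaceT => t; rewrite inE /= in_itv /= => /hd ht.
  exact/differentiable_continuous/derivable1_diffP/ex_derive.
rewrite in_itv /= => t01; rewrite /h scale1r scale0r addr0 subr0 mulr1 subrKC.
by exists t.
Qed.

End Lines.

(** * Block vectors and the proximal response *)

Section Blocks.
Context {R : realType} {N : nat} {n : 'I_N -> nat}.
Local Notation profile := 'rV[R]_(\sum_i n i)%N.
Implicit Types (x y u : profile) (i j : 'I_N).

Lemma submxrow_deviate x i (z : 'rV[R]_(n i)) : submxrow (deviate x z) i = z.
Proof. by rewrite mxrowK dfwithin. Qed.

Lemma submxrow_deviate_neq x i (z : 'rV[R]_(n i)) j :
  j != i -> submxrow (deviate x z) j = submxrow x j.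
Proof. by move=> ji; rewrite mxrowK dfwithout// eq_sym. Qed.

Lemma submxrowZ a x i : submxrow (a *: x) i = a *: submxrow x i.
Proof. by apply/rowP => k; rewrite !mxE. Qed.

Lemma deviate_id x i : deviate x (submxrow x i) = x.
Proof.
apply/mxrowP => j; have [->|ji] := eqVneq j i; first by rewrite submxrow_deviate.
by rewrite submxrow_deviate_neq.
Qed.

(** [deviate 0 v] embeds [v] as block [i] among zero blocks: a move of player [i] alone is a move
    along a line of profiles. *)
Lemma deviate_line x i (z v : 'rV[R]_(n i)) t :
  deviate x (z + t *: v) = deviate x z + t *: deviate 0 v.
Proof.
apply/mxrowP => j; rewrite submxrowD submxrowZ.
have [->|ji] := eqVneq j i; first by rewrite !submxrow_deviate.
by rewrite !submxrow_deviate_neq// submxrow0 scaler0 addr0.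
Qed.

Lemma dotv_blocks x y : dotv x y = \sum_i dotv (submxrow x i) (submxrow y i).
Proof.
rewrite /dotv sig_big_dep/= (reindex _ tagnat.sig_bij_on)/=.
by apply: eq_bigr => k _; rewrite !mxE !tagnat.sig2K.
Qed.

Lemma dotv_deviate0 i (v : 'rV[R]_(n i)) u :
  dotv (deviate 0 v) u = dotv v (submxrow u i).
Proof.
rewrite dotv_blocks (bigD1 i)//= submxrow_deviate big1 ?addr0// => j ji.
by rewrite submxrow_deviate_neq// submxrow0 dotv0l.
Qed.

Lemma enorm_submxrow x : enorm x = enorm (\row_i enorm (submxrow x i)).
Proof.
rewrite !enormE dotv_blocks; congr Num.sqrt; apply: eq_bigr => i _.
by rewrite !mxE -expr2 enorm_sqr.
Qed.

Lemma enorm_submxrow_le x i : enorm (submxrow x i) <= enorm x.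
Proof.
rewrite [leRHS]enorm_submxrow.
have := coord_le_enorm (\row_i enorm (submxrow x i)) i.
by rewrite [(\row_i _) 0 i]mxE ger0_norm.
Qed.

Lemma dotv_phessian i (g : profile -> R) (p u : profile) (v : 'rV[R]_(n i)) :
  dotv (deviate 0 v) (u *m (hessian g p)^T) =
  \sum_j dotv v (submxrow u j *m (phessian i j g p)^T).
Proof.
rewrite dotv_deviate0 -mul_submxrow -[in LHS](submxrowK u).
rewrite -[submxrow _ i]submxcolK mul_mxrow_mxcol.
have -> (F : 'I_N -> 'rV[R]_(n i)) : dotv v (\sum_j F j) = \sum_j dotv v (F j).
  by elim/big_rec2 : _ => [|j a b _ <-]; rewrite ?dotv0r ?dotvDr.
apply: eq_bigr => j _; congr (dotv v (_ *m _)).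
by rewrite tr_submxblock submxblockEh.
Qed.

End Blocks.

Lemma submxrow_continuous {R : realType} {N : nat} {n : 'I_N -> nat} i :
  continuous (fun x : 'rV[R]_(\sum_i n i)%N => submxrow x i).
Proof.
apply: (@lipschitz_continuous _ _ _ _ 1) => x y; rewrite mul1r -submxrowB.
rewrite [leLHS]/Num.Def.normr/= mx_normrE bigmax_le// => -[k j] _.
by rewrite ord1 mxE; exact: coord_le_norm.
Qed.

Lemma deviate_continuous {R : realType} {N : nat} {n : 'I_N -> nat}
    (x : 'rV[R]_(\sum_i n i)%N) i : continuous (@deviate R N n x i).
Proof.
apply: (@lipschitz_continuous _ _ _ _ (Num.sqrt (n i)%:R)) => z w.
have := deviate_line x w (z - w) 1; rewrite !scale1r subrKC => ->.
rewrite addrC addKr (le_trans (norm_le_enorm _))// enormE dotv_deviate0.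
by rewrite submxrow_deviate -enormE enorm_le_norm.
Qed.

Lemma continuousD_enorm_sqr {R : realType} (T : topologicalType) m (g : T -> R)
    (h : T -> 'rV[R]_m) a t :
  {for t, continuous g} -> {for t, continuous h} ->
  {for t, continuous (fun u => g u + a * enorm (h u) ^+ 2)}.
Proof.
move=> cg ch; apply: continuousD => //.
apply: (@continuousM _ _ (fun=> a)); first exact: cst_continuous.
apply: (@continuous_comp _ _ _ (fun u => enorm (h u)) (fun b : R => b ^+ 2)).
  by apply: continuous_comp => //; exact: enorm_continuous.
exact: exprn_continuous.
Qed.

(** * Contraction of the proximal response, its fixed point and the Nash equilibrium *)

Section Game.
Context {R : realType} {N : nat} {n : 'I_N -> nat}.
Local Notation profile := 'rV[R]_(\sum_i n i)%N.
Variables (X : forall i, set 'rV[R]_(n i)) (f : 'I_N -> profile -> R) (mu : R).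
Arguments X : clear implicits.
Hypothesis X0 : forall i, X i !=set0.
Hypothesis Xclosed : forall i, closed (X i).
Hypothesis Xcompact : forall i, compact (X i).
Hypothesis Xconvex : forall i, convex_set (X i).
Hypothesis f_own : forall i x, rivals_feasible X i x ->
  exists W : set 'rV[R]_(n i), [/\ open W, X i `<=` W, convex_set W
    & convex_function W (fun z => f i (deviate x z))].
Hypothesis f_joint : forall i, exists U : set profile,
  [/\ open U, feasible X `<=` U & twice_differentiable_on U (f i)].
Hypothesis f_cross : forall i j, j != i ->
  has_ubound (cross_hessian_norms X f i j).
Hypothesis mu_gt0 : 0 < mu.
Hypothesis Gamma_lt1 : opnorm (Gamma X f mu) < 1.

Lemma feasible_rivals i x : feasible X x -> rivals_feasible X i x.
Proof. by move=> Xx j _; exact: Xx. Qed.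

Lemma feasible_deviate i x z : feasible X x -> X i z -> feasible X (deviate x z).
Proof.
move=> Xx Xz j; have [->|ji] := eqVneq j i; first by rewrite submxrow_deviate.
by rewrite submxrow_deviate_neq//; exact: Xx.
Qed.

Lemma feasible_nonempty : feasible X !=set0.
Proof.
exists (\mxrow_i sval (cid (X0 i))) => i; rewrite mxrowK.
exact: svalP (cid (X0 i)).
Qed.

Lemma feasible_line x y t : feasible X x -> feasible X y -> 0 <= t <= 1 ->
  feasible X (x + t *: (y - x)).
Proof.
move=> Xx Xy t01 i; rewrite submxrowD submxrowZ submxrowB.
exact: (convex_setP (@Xconvex i) (Xx i) (Xy i) t01).
Qed.

Lemma objective_differentiable i x : feasible X x -> differentiable (f i) x.
Proof. by have [U [_ XU fU]] := f_joint i => /XU/fU[]. Qed.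

(* Convexity makes the gradient monotone along a line, so the second derivative
   at the origin of the line is nonnegative. *)
Lemma phessian_ge0 i x (v : 'rV[R]_(n i)) : feasible X x ->
  0 <= dotv v (v *m (phessian i i (f i) x)^T).
Proof.
move=> Xx; have [U [oU XU fU]] := f_joint i.
have [W [oW XW cW fW]] := f_own (@feasible_rivals i _ Xx).
pose e : profile := deviate 0 v; pose z := submxrow x i.
have dev (t : R) : x + t *: e = deviate x (z + t *: v).
  by rewrite deviate_line deviate_id.
have -> : dotv v (v *m (phessian i i (f i) x)^T) =
    dotv e (e *m (hessian (f i) x)^T).
  rewrite dotv_phessian (bigD1 i)//= submxrow_deviate big1 ?addr0// => j ji.
  by rewrite submxrow_deviate_neq// submxrow0 mul0mx dotv0r.
have Ue0 : U (x + 0 *: e) by rewrite scale0r addr0; exact: XU.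
have := is_derive_gradient_line e fU Ue0; rewrite scale0r addr0.
move=> /(@derive_ge _ _ _ 0 0); rewrite oppr0; apply.
have Ux : U x by exact: XU.
(* Differentiability is known on [U] and convexity on [W]; the parameter [t] below is taken small
   enough for the line to stay in both. The inequalities from 0 to [t] and from [t] to 0 are then
   added. *)
have tangent (a b : R) : U (x + a *: e) -> W (z + a *: v) -> W (z + b *: v) ->
    (b - a) * dotv e (gradient (f i) (x + a *: e)) <=
    f i (x + b *: e) - f i (x + a *: e).
  move=> Ua Wa Wb; rewrite -dotvZl.
  have ab : x + b *: e = x + a *: e + (b - a) *: e.
    by rewrite -addrA -scalerDl subrKC.
  rewrite ab; apply: gradient_tangent; first by have [] := fU _ Ua.
  move=> t /andP[t0 t1]; rewrite -ab.
  have t01 : 0 <= t <= 1 by rewrite (ltW t0).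
  have := convex_functionP fW Wa Wb t01.
  rewrite opprD addrACA subrr add0r -scalerBl scalerA -addrA -scalerDl -!dev.
  by rewrite scalerA -addrA -scalerDl.
have Wz : W z by apply: XW; exact: Xx.
near=> t; rewrite mul0r !subr0 mul0r subr0.
have t0 : 0 < t by near: t; exact: nbhs_right_gt.
have Ut : U (x + t *: e) by near: t; exact: near_line.
have Wt : W (z + t *: v) by near: t; exact: near_line.
have := tangent 0 t; have := tangent t 0; rewrite !scale0r !addr0.
move=> /(_ Ut Wt Wz) h1 /(_ Ux Wz Wt) h2.
by rewrite -(ler_pM2l t0); lra.
Unshelve. all: by end_near. Qed.

(* [inf] and [sup] are meaningful here because the sets involved are nonempty
   and bounded on the relevant side. *)
Lemma zeta_min_le i x : feasible X x ->
  zeta_min X f i <= lambda_min (phessian i i (f i) x).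
Proof.
move=> Xx; apply: ge_inf; last by exists x.
exists 0 => _ [y Xy <-]; apply: lambda_min_ge0 => v; exact: phessian_ge0.
Qed.

(** This makes the denominators [mu + zeta_min X f i] of [Gamma] positive. *)
Lemma zeta_min_ge0 i : 0 <= zeta_min X f i.
Proof.
apply: lb_le_inf.
  have [x Xx] := feasible_nonempty.
  by exists (lambda_min (phessian i i (f i) x)), x.
by move=> _ [y Xy <-]; apply: lambda_min_ge0 => v; exact: phessian_ge0.
Qed.

Lemma zeta_max_ge i j x : j != i -> feasible X x ->
  opnorm (phessian i j (f i) x) <= zeta_max X f i j.
Proof.
move=> ji Xx; apply: sup_upper_bound; last by exists x.
by split; [exists (opnorm (phessian i j (f i) x)); exists x|exact: f_cross].
Qed.

(** Minimality without the choice made by [argmin]: an equilibrium satisfies it directly, and can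
    thus be compared with a selected response through the contraction estimate. *)
Definition is_prox_response i (y : profile) (z : 'rV[R]_(n i)) : Prop :=
  X i z /\ forall w, X i w ->
    f i (deviate y z) + mu / 2 * enorm (z - submxrow y i) ^+ 2
      <= f i (deviate y w) + mu / 2 * enorm (w - submxrow y i) ^+ 2.

Lemma prox_response_first_order i y z w : feasible X y -> is_prox_response y z ->
  X i w ->
  0 <= dotv (w - z) (submxrow (gradient (f i) (deviate y z)) i)
       + mu * dotv (z - submxrow y i) (w - z).
Proof.
move=> Xy [Xz zmin] Xw; set p := deviate y z; set a := z - _; set b := w - z.
have Xp : feasible X p by exact: feasible_deviate.
pose e : profile := deviate 0 b; rewrite -dotv_deviate0 -/e.
have /diff_derivable fd := objective_differentiable i Xp.
have := @is_derive_line R _ (f i) p e 0; rewrite scale0r addr0 => /(_ (fd e)).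
rewrite derive_gradient; last exact: objective_differentiable.
(* The two constants are the coefficients of [t] and [t^2] in the proximal term along
   [z + t *: b]. *)
move=> /(@derive_ge _ _ _ (mu * dotv a b) (mu / 2 * enorm b ^+ 2)).
rewrite -subr_ge0 opprK; apply; near=> t.
have t0 : 0 < t by near: t; exact: nbhs_right_gt.
have t1 : t <= 1 by near: t; exact: nbhs_right_le.
have Xt : X i (z + t *: b) by apply: (convex_setP (@Xconvex i)) => //; rewrite (ltW t0).
have := zmin _ Xt; rewrite deviate_line -/e -/p scale0r addr0 addrAC -/a.
by rewrite enorm_sqr_line; lra.
Unshelve. all: by end_near. Qed.

Lemma prox_response_contractive i y y' z z' :
  feasible X y -> feasible X y' -> @is_prox_response i y z -> is_prox_response y' z' ->
  enorm (z - z') <= \sum_j Gamma X f mu i j * enorm (submxrow y j - submxrow y' j).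
Proof.
move=> Xy Xy' pz pz'; have [v vE] : exists v, v = z - z' by exists (z - z').
rewrite -vE.
have Xz : X i z by case: pz.
have Xz' : X i z' by case: pz'.
pose p := deviate y z; pose p' := deviate y' z'; pose e : profile := deviate 0 v.
have Xp : feasible X p by exact: feasible_deviate.
have Xp' : feasible X p' by exact: feasible_deviate.
have [U [_ XU fU]] := f_joint i.
(* The gradient difference is tested in the direction [e] only, which singles out row [i] of the
   Hessian blocks of [f i]. *)
have [|t t01] := @gradient_mean_value _ _ U (f i) p' p e fU.
  by move=> t t01; apply: XU; exact: feasible_line.
set q := p' + _; have Xq : feasible X q by exact: feasible_line.
rewrite dotv_phessian [\sum_j dotv _ _](bigD1 i)//= !dotv_deviate0.
rewrite submxrowB !submxrow_deviate -vE => meq.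
(* Each response is tested against the other one; the sum of the two inequalities is [key] below. *)
have h1 := prox_response_first_order Xy pz Xz'.
have h2 := prox_response_first_order Xy' pz' Xz.
have v' : z' - z = - v by rewrite vE opprB.
rewrite v' -vE in h1 h2.
have own : zeta_min X f i * dotv v v <= dotv v (v *m (phessian i i (f i) q)^T).
  apply: le_trans (lambda_min_le _ _).
  by rewrite ler_wpM2r ?dotv_ge0// zeta_min_le.
(* Deviations change block [i] only, so the other blocks of [p - p'] are those of [y - y']. *)
have cross : - (enorm v * \sum_(j | j != i) zeta_max X f i j *
      enorm (submxrow y j - submxrow y' j)) <=
    \sum_(j | j != i) dotv v (submxrow (p - p') j *m (phessian i j (f i) q)^T).
  rewrite mulr_sumr -sumrN; apply: ler_sum => j ji.
  rewrite lerNl -dotvNl (le_trans (dotv_le _ _))// enormN ler_wpM2l//.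
  rewrite (le_trans (opnormP _ _))//.
  rewrite submxrowB !submxrow_deviate_neq// ler_wpM2r//.
  exact: zeta_max_ge.
have prox : dotv (submxrow y i - submxrow y' i) v <=
    enorm (submxrow y i - submxrow y' i) * enorm v by exact: dotv_le.
have d0 : 0 < mu + zeta_min X f i by rewrite ltr_wpDr ?zeta_min_ge0.
set S := \sum_(j | j != i) _ in cross; set d := enorm (_ - _) in prox.
have main : (mu + zeta_min X f i) * enorm v <= mu * d + S.
  have S0 : 0 <= S.
    apply: sumr_ge0 => j ji; rewrite mulr_ge0//.
    by rewrite (le_trans (opnorm_ge0 _) (zeta_max_ge ji Xp)).
  have d_ge0 : 0 <= d by exact: enorm_ge0.
  (* The inequalities give the estimate multiplied by [enorm v]; when this factor is zero, the
     nonnegativity of the right-hand side suffices. *)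
  have [v0|v0] := eqVneq (enorm v) 0.
    by rewrite v0 mulr0 addr_ge0// mulr_ge0// ltW.
  have vgt0 : 0 < enorm v by rewrite lt_neqAle eq_sym v0 enorm_ge0.
  have key : mu * dotv v v <= mu * dotv (submxrow y i - submxrow y' i) v
      - dotv v (submxrow (gradient (f i) p) i)
      + dotv v (submxrow (gradient (f i) p') i).
    have vv : dotv v v = dotv z v - dotv z' v by rewrite -dotvBl -vE.
    by move: h1 h2; rewrite vv !dotvBl !dotvNl !dotvNr -/p -/p'; lra.
  have muprox := ler_wpM2l (ltW mu_gt0) prox.
  rewrite -(ler_pM2r vgt0) -mulrA -expr2 enorm_sqr !mulrDl.
  by move: key muprox own cross meq; lra.
rewrite [\sum_j Gamma _ _ _ _ _ * _](bigD1 i)//= mxE eqxx.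
under eq_bigr => j ji do rewrite mxE (negbTE ji) mulrAC.
by rewrite -mulr_suml mulrAC -mulrDl ler_pdivlMr// mulrC.
Qed.

Lemma prox_response_exists i y : feasible X y -> exists z, @is_prox_response i y z.
Proof.
move=> Xy; have [||c /set_mem Xc cmin] := @EVT_min_rV R (n i) (fun z =>
  f i (deviate y z) + mu / 2 * enorm (z - submxrow y i) ^+ 2) (X i) (X0 i).
- exact: Xcompact.
- apply: continuous_in_subspaceT => z /set_mem Xz.
  apply: (@continuousD_enorm_sqr _ _ _ (fun z => f i (deviate y z))
      (fun z => z - submxrow y i)).
    apply: continuous_comp; first exact: deviate_continuous.
    exact/differentiable_continuous/objective_differentiable/feasible_deviate.
  apply: (@continuousB _ _ _ id (fun=> submxrow y i)); first exact: cvg_id.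
  exact: cst_continuous.
by exists c; split => // w Xw; apply: cmin; exact: mem_set.
Qed.

(** [argmin] is a choice with a default value; the existence of a minimizer is what gives it
    minimality. *)
Lemma prox_best_responseP i y : feasible X y ->
  @is_prox_response i y (prox_best_response X f mu i y).
Proof. by move=> /(@prox_response_exists i)/getPex. Qed.

Lemma feasible_compact : compact (feasible X).
Proof.
apply: bounded_closed_compact; last first.
  have -> : feasible X = \bigcap_i ((fun x => submxrow x i) @^-1` X i).
    by apply/seteqP; split => [x Xx i _|x Xx i]; exact: Xx.
  apply: closed_bigI => i _; apply: closed_comp => // x _.
  exact: submxrow_continuous.
have bnd i : exists2 M : R, 0 < M & forall z, X i z -> `|z| < M.
  have /ex_strict_bound_gt0[M M0 XM] : bounded_set (X i).
    by apply: compact_bounded; exact: Xcompact.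
  by exists M => // z; exact: XM.
pose M i := sval (cid2 (bnd i)).
have M0 i : 0 < M i by rewrite /M; case: cid2.
have XM i z : X i z -> `|z| < M i by rewrite /M; case: cid2 => /= ? _; apply.
exists (\sum_i M i); split; first exact: num_real.
move=> K MK x Xx /=; rewrite [leLHS]/Num.Def.normr/= mx_normrE.
have K0 : 0 <= K by rewrite (le_trans _ (ltW MK))// sumr_ge0// => i _; exact: ltW.
apply: bigmax_le => // -[k j] _ /=; rewrite ord1 -(tagnat.sig2K j).
have -> : x 0 (tagnat.Rank _ (tagnat.sig2 j)) =
  submxrow x (tagnat.sig1 j) 0 (tagnat.sig2 j) by rewrite mxE.
rewrite (le_trans (coord_le_norm _ _))// (le_trans (ltW (XM _ _ (Xx _))))//.
rewrite (le_trans _ (ltW MK))// (bigD1 (tagnat.sig1 j))//= lerDl.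
by apply: sumr_ge0 => i _; exact: ltW.
Qed.

(** The block distances between responses are dominated coordinatewise by [Gamma] applied to the
    block distances between profiles, and [enorm] is monotone on nonnegative vectors. *)
Lemma prox_profile_contractive (y y' z z' : profile) : feasible X y -> feasible X y' ->
  (forall i, is_prox_response y (submxrow z i)) ->
  (forall i, is_prox_response y' (submxrow z' i)) ->
  enorm (z - z') <= opnorm (Gamma X f mu) * enorm (y - y').
Proof.
move=> Xy Xy' pz pz'; rewrite [enorm (y - y')]enorm_submxrow enorm_submxrow.
apply: le_trans (opnormP _ _); apply: enorm_le => i; rewrite !mxE enorm_ge0/=.
rewrite submxrowB (le_trans (prox_response_contractive Xy Xy' (pz i) (pz' i)))//.
by apply: ler_sum => j _; rewrite [(\row_i _) 0 j]mxE [_^T _ _]mxE submxrowB mulrC.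
Qed.

Definition prox_profile y : profile := \mxrow_i prox_best_response X f mu i y.

Lemma prox_profileP i y : feasible X y ->
  is_prox_response y (submxrow (prox_profile y) i).
Proof. by rewrite mxrowK; exact: prox_best_responseP. Qed.

Lemma prox_profile_feasible y : feasible X y -> feasible X (prox_profile y).
Proof. by move=> Xy i; have [] := prox_profileP i Xy. Qed.

Lemma prox_profile_lipschitz y y' : feasible X y -> feasible X y' ->
  enorm (prox_profile y - prox_profile y') <=
  opnorm (Gamma X f mu) * enorm (y - y').
Proof.
by move=> Xy Xy'; apply: prox_profile_contractive => // i; exact: prox_profileP.
Qed.

Lemma prox_profile_fixpoint : exists2 y, feasible X y & prox_profile y = y.
Proof.
have := Gamma_lt1; set q := opnorm (Gamma X f mu) => q1.
pose F y := enorm (y - prox_profile y).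
have [||c /set_mem Xc cmin] := @EVT_min_rV R _ F _ feasible_nonempty.
- exact: feasible_compact.
(* The factor 2 bounds [1 + q]: one for the move of the point, [q] for that of its response. The
   square root converts [enorm] to the sup norm. *)
- apply: (@lipschitz_within_continuous _ _ _ _ _ (2 * Num.sqrt (\sum_i n i)%:R)).
  move=> y y' Xy Xy'.
  have h a b : feasible X a -> feasible X b -> F a - F b <= 2 * enorm (a - b).
    move=> Xa Xb; rewrite lerBlDl (le_trans (enormB b _ _))//.
    rewrite mulr_natl mulr2n addrCA lerD2l.
    rewrite (le_trans (enormB (prox_profile b) _ _))// lerD2l.
    rewrite (le_trans (prox_profile_lipschitz Xb Xa))// enormC.
    by rewrite ler_piMl// ltW.
  rewrite -mulrA; apply: (@le_trans _ _ (2 * enorm (y - y'))).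
    apply/ler_normlP; split; last exact: h.
    by rewrite opprB [enorm (y - y')]enormC; exact: h.
  by rewrite ler_wpM2l// enorm_le_norm.
exists c => //; apply/esym/eqP; rewrite -subr_eq0; apply/eqP/enorm_eq0/eqP.
have Xc' := prox_profile_feasible Xc.
(* Comparing the minimizer [c] with its own response gives [F c <= q * F c], hence [F c = 0]. *)
have h1 : F (prox_profile c) <= q * F c := prox_profile_lipschitz Xc Xc'.
have h2 : F c <= F (prox_profile c) := cmin _ (mem_set Xc').
have : (1 - q) * F c <= 0 by rewrite mulrBl mul1r subr_le0 (le_trans h2).
by rewrite pmulr_rle0 ?subr_gt0// eq_le enorm_ge0 andbT.
Qed.

(** The proximal term centred at [x] vanishes at the equilibrium and is nonnegative elsewhere. *)
Lemma nash_prox_response i x : nash_equilibrium X f x ->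
  is_prox_response x (submxrow x i).
Proof.
move=> [Xx xmin]; split=> [|w Xw]; first exact: Xx.
rewrite deviate_id subrr enorm0 expr0n /= mulr0 addr0 (le_trans (xmin i w Xw))//.
by rewrite lerDl mulr_ge0 ?exprn_ge0// divr_ge0// ltW.
Qed.

(** At its own centre the proximal term has zero gradient, so the first-order condition is that of
    [f i] alone; convexity in the own variable makes it sufficient. *)
Lemma prox_response_nash x : feasible X x ->
  (forall i, is_prox_response x (submxrow x i)) -> nash_equilibrium X f x.
Proof.
move=> Xx xp; split=> // i w Xw; have Xi := Xx i.
have := prox_response_first_order Xx (xp i) Xw.
rewrite subrr dotv0l mulr0 addr0 deviate_id -dotv_deviate0 => fo.
have [W [_ XW _ fW]] := f_own (@feasible_rivals i _ Xx).
have xw : x + deviate 0 (w - submxrow x i) = deviate x w.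
  have := deviate_line x (submxrow x i) (w - submxrow x i) 1.
  by rewrite !scale1r subrKC deviate_id.
rewrite -subr_ge0 (le_trans fo)// -xw; apply: gradient_tangent.
  exact: objective_differentiable.
move=> t /andP[t0 t1]; rewrite xw -[X in X + _](deviate_id x i) -deviate_line.
rewrite -[X in (1 - t) * f i X](deviate_id x i).
by apply: (convex_functionP fW); [exact: XW|exact: XW|rewrite ltW].
Qed.

(** Existence comes from the fixed point, uniqueness from the contraction between two
    self-responding profiles. The second clause, where [xstar] is its own response, drives the error
    recursion of the scheme. *)
Lemma nash_unique : exists2 xstar : profile, unique (nash_equilibrium X f) xstar
  & forall y, feasible X y ->
      enorm (prox_profile y - xstar) <= opnorm (Gamma X f mu) * enorm (y - xstar).
Proof.
have [c Xc cfix] := prox_profile_fixpoint.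
have cprox i : is_prox_response c (submxrow c i).
  by rewrite -[X in submxrow X i]cfix; exact: prox_profileP.
exists c; last first.
  by move=> y Xy; apply: prox_profile_contractive => // i; exact: prox_profileP.
split; first exact: prox_response_nash.
move=> x xnash; have Xx : feasible X x by case: xnash.
have := prox_profile_contractive Xc Xx cprox (fun i => nash_prox_response i xnash).
move=> h; apply/eqP; rewrite -subr_eq0; apply/eqP/enorm_eq0/eqP.
have : (1 - opnorm (Gamma X f mu)) * enorm (c - x) <= 0.
  by rewrite mulrBl mul1r subr_le0.
by rewrite pmulr_rle0 ?subr_gt0// eq_le enorm_ge0 andbT.
Qed.

End Game.

(** * Almost sure convergence *)

Lemma nneseries_lty {R : realType} (a : nat -> R) :
  cvgn (series a) -> (\sum_(k <oo) (a k)%:E < +oo)%E.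
Proof.
move=> ca; rewrite (_ : (\sum_(k <oo) (a k)%:E)%E = limn (EFin \o series a)).
  by rewrite EFin_lim// ltry.
by congr (limn _); apply/funext => m /=; rewrite /series /= sumEFin.
Qed.

(** The terms are bounded by the sum [L] of the series, so [a k ^+ 2 <= L * a k]. *)
Lemma cvg_series_sqr {R : realType} (a : nat -> R) : (forall k, 0 <= a k) ->
  cvgn (series a) -> cvgn (series (fun k => a k ^+ 2)).
Proof.
move=> a0 ca.
have a_le k : a k <= limn (series a).
  apply: (@le_trans _ _ (series a k.+1)).
    by rewrite seriesEnat /= big_nat_recr//= lerDr sumr_ge0.
  by apply: nondecreasing_cvgn_le => //; exact: nondecreasing_series.
apply: (@series_le_cvg _ _ (limn (series a) *: a)).
- by move=> k; exact: sqr_ge0.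
- by move=> k; rewrite fctE mulr_ge0// (le_trans (a0 k)).
- by move=> k; rewrite fctE expr2 ler_wpM2r.
- exact: is_cvg_seriesZ.
Qed.

Lemma perturbed_contraction_cvg {R : realType} (q : R) (e d : nat -> R) :
  0 <= q < 1 -> (forall k, 0 <= e k) -> (forall k, e k.+1 <= q * e k + d k) ->
  d @ \oo --> 0 -> e @ \oo --> 0.
Proof.
move=> /andP[q0 q1] e0 step d0; apply/cvgrPdist_le => eps eps0.
(* Chosen so that [eps / 2] is the fixed point of [s -> q s + b]; the bound [eK] then passes through
   the induction. *)
pose b := (1 - q) * (eps / 2).
have b0 : 0 < b by rewrite mulr_gt0 ?divr_gt0// subr_gt0.
have /cvgrPdist_le/(_ _ b0)[K _ dK] := d0.
have eK m : e (m + K)%N <= q ^+ m * e K + eps / 2.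
  elim: m => [|m ih].
    by rewrite add0n expr0 mul1r lerDl divr_ge0// ltW.
  rewrite addSn (le_trans (step _))//.
  have := dK (m + K)%N (leq_addl _ _); rewrite sub0r normrN => /ler_normlP[_ dm].
  have := ler_wpM2l q0 ih; rewrite exprS; rewrite /b in dm; lra.
have qcvg : q ^+ m * e K @[m --> \oo] --> 0.
  rewrite -[X in _ --> X](mul0r (e K)); apply: cvgMl.
  by apply: cvg_expr; rewrite ger0_norm.
have /cvgrPdist_le/(_ (eps / 2)) := qcvg; rewrite divr_gt0// => /(_ isT)[M _ qM].
exists (M + K)%N => // k /= MKk; rewrite sub0r normrN ger0_norm//.
have Kk : (K <= k)%N by rewrite (leq_trans (leq_addl _ _) MKk).
have := qM (k - K)%N; rewrite /= leq_subRL// addnC => /(_ MKk).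
rewrite sub0r normrN => /ler_normlP[_ h].
by have := eK (k - K)%N; rewrite subnK//; lra.
Qed.

Section Probability.
Context {R : realType} {disp : measure_display} {T : measurableType disp}.
Variable P : probability T R.

(* Only the defining identity on the whole space is needed. *)
Lemma cond_expectation_integral_le (G : set_system T) (Z Y : T -> R) (c : R) :
  G setT -> 0 <= c -> is_cond_expectation P G Z Y ->
  {ae P, forall w, Y w <= c} -> (\int[P]_w (Z w)%:E <= c%:E)%E.
Proof.
move=> GT c0 [iZ iY _ /(_ _ GT) <-] Yc.
(* [Y] may take negative values, so its negative part is dropped; since [0 <= c], the positive part
   is still at most [c] almost everywhere. *)
rewrite integralE (@le_trans _ _ (\int[P]_w (EFin \o Y)^\+ w)%E)//.
  by rewrite geeDl// oppe_le0 integral_ge0.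
have /integrableP[mY _] := iY.
apply: (@le_trans _ _ (\int[P]_w (cst c%:E w))%E); last first.
  by rewrite integral_cst//= probability_setT mule1.
apply: ae_ge0_le_integral => //.
- exact: measurable_funepos.
- by apply: filterS Yc => w Ywc _; rewrite funeposE /= ge_max !lee_fin Ywc.
Qed.

(* The expectation of the whole series is finite, hence the series converges
   almost surely. *)
Lemma summable_expectation_cvg0 (Z : nat -> T -> R) (a : nat -> R) :
  (forall k w, 0 <= Z k w) -> (forall k, integrable_rv P (Z k)) ->
  cvgn (series a) -> (forall k, \int[P]_w (Z k w)%:E <= (a k)%:E)%E ->
  {ae P, forall w, Z k w @[k --> \oo] --> 0}.
Proof.
move=> Z0 iZ ca Za.
have mZ k : measurable_fun setT (fun w => (Z k w)%:E).
  by have /integrableP[] := iZ k.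
pose S w := (\sum_(k <oo) (Z k w)%:E)%E.
have S0 w : (0 <= S w)%E by apply: nneseries_ge0 => k _ _; rewrite lee_fin.
have iS : P.-integrable setT S.
  apply/integrableP; split.
    by apply: ge0_emeasurable_sum => // k w _ _; rewrite lee_fin.
  under eq_integral do rewrite gee0_abs//.
  (* Monotone convergence exchanges the integral and the series of nonnegative terms. *)
  rewrite integral_nneseries//; last by move=> k w _; rewrite lee_fin.
  apply: le_lt_trans (nneseries_lty ca); apply: lee_nneseries => k _; last exact: Za.
  by move=> _; apply: integral_ge0 => w _; rewrite lee_fin.
apply: filterS (integrable_ae measurableT iS) => w /(_ I) Sw.
by apply/cvg_series_cvg_0/nnseries_is_cvg => //; rewrite ltey_eq Sw.
Qed.

End Probability.

(** * Convergence of the scheme along almost every path *)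

Unset Implicit Arguments.
Set Strict Implicit.
Set Printing Implicit Defensive.

Theorem proposition2 (R : realType) (N d : nat) (n : 'I_N -> nat)
    (disp : measure_display) (T : measurableType disp) (P : probability T R)
    (xi : T -> 'rV[R]_d)
    (psi : 'I_N -> 'rV[R]_(\sum_i n i)%N -> 'rV[R]_d -> R)
    (X : forall i, set 'rV[R]_(n i)) (mu : R)
    (alpha : 'I_N -> nat -> R) (F : nat -> set_system T)
    (x : nat -> T -> 'rV[R]_(\sum_i n i)%N)
    (xi_measurable : vec_measurable measurable xi)
    (mu_gt0 : 0 < mu)
    (hA : assumptionA P xi psi X)
    (hB : assumptionB X (objective P xi psi) mu)
    (alpha_ge0 : forall i k, 0 <= alpha i k)
    (alpha_summable : forall i, cvgn (series (alpha i)))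
    (hx : inexact_prox_scheme P X (objective P xi psi) mu alpha F x) :
  exists2 xstar : 'rV[R]_(\sum_i n i)%N,
    unique (nash_equilibrium X (objective P xi psi)) xstar
    & forall i, {ae P, forall w,
        (fun k => submxrow (x k w) i) @ \oo --> submxrow xstar i}.
Proof.
have {hA}[sets own joint _ _ _] := hA; have {hB}[cross g1] := hB.
set f := objective P xi psi in own joint cross g1 hx *.
have [xstar xnash track] : exists2 xstar : 'rV[R]_(\sum_i n i)%N,
    unique (nash_equilibrium X f) xstar & forall y, feasible X y ->
      enorm (prox_profile X f mu y - xstar) <= opnorm (Gamma X f mu) * enorm (y - xstar).
  apply: nash_unique => //.
  1-4: by move=> i; have [] := sets i.
  - by move=> i y /own[W [[oW XW cW] [_ fW _]]]; exists W.
  - by move=> i; have [U [oU XU _ fU]] := joint i; exists U.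
exists xstar => // i.
have [filt _ Xx inexact] := hx.
pose Z j k w := enorm (submxrow (x k.+1 w) j
                       - prox_best_response X f mu j (x k w)) ^+ 2.
have Zcvg j : {ae P, forall w, Z j k w @[k --> \oo] --> 0}.
  apply: (@summable_expectation_cvg0 _ _ _ _ _ (fun k => alpha j k ^+ 2)).
  - by move=> k w; exact: sqr_ge0.
  - by move=> k; have [Y []] := inexact j k.
  - exact: cvg_series_sqr.
  - move=> k; have [Y condY Yle] := inexact j k.
    apply: cond_expectation_integral_le _ (sqr_ge0 _) condY Yle.
    have [[F0 FC _] _ _] := filt k; rewrite -(setD0 setT); exact: FC.
(* The recursion for the whole profile involves the errors of all players, so their finitely many
   null sets are merged into one. *)
have Zall : {ae P, forall w, forall j, Z j k w @[k --> \oo] --> 0}.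
  by apply: filter_forall => j; exact: Zcvg.
apply: filterS Zall => w Zw.
pose e k := enorm (x k w - xstar).
pose dist k := enorm (x k.+1 w - prox_profile X f mu (x k w)).
have dist0 : dist k @[k --> \oo] --> 0.
  (* The squared profile error is the sum of the squared block errors [Z j k w]. *)
  have -> : dist = fun k => Num.sqrt (\sum_j Z j k w).
    apply/funext => k; rewrite /dist enormE dotv_blocks; congr Num.sqrt.
    by apply: eq_bigr => j _; rewrite -enorm_sqr submxrowB mxrowK.
  have sum0 : \sum_j Z j k w @[k --> \oo] --> \sum_(j < N) (0 : R).
    by apply: cvg_big => [|j _]; [exact: add_continuous|exact: Zw].
  rewrite big1// in sum0; rewrite -[X in _ --> X]sqrtr0.
  by apply: continuous_cvg sum0; exact: sqrt_continuous.
(* The triangle inequality through the exact response splits the new error into the contracted old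
   one, by [track], and the inexactness [dist k]. *)
have e0 : e k @[k --> \oo] --> 0.
  apply: (@perturbed_contraction_cvg _ (opnorm (Gamma X f mu)) e dist) => //.
  - by rewrite opnorm_ge0.
  - by move=> k; exact: enorm_ge0.
  - move=> k; rewrite addrC (le_trans (enormB (prox_profile X f mu (x k w)) _ _))//.
    by rewrite lerD2l; exact: track.
apply/cvgrPdist_le => eps eps0.
have /cvgrPdist_le/(_ _ eps0)[K _ eK] := e0.
exists K => // k /eK /=; rewrite sub0r normrN; apply: le_trans.
rewrite -submxrowB (le_trans (norm_le_enorm _))// (le_trans (enorm_submxrow_le _ _))//.
by rewrite enormC ler_norm.
Qed.
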